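(* Given a parameter value $\kappa\ge0$ and initial data $(A_0,B_0)\in\mathcal{D}$, the initial value problem $$\ddot A(t)+\kappa A(t)=\Lambda(A(t),\dot A(t))\,\mathrm{cof}\,A(t),\qquad (A(0),\dot A(0))=(A_0,B_0),$$ has a unique global solution $A\in C^0(\mathbb{R},\mathrm{SL}(2,\mathbb{R}))\cap C^2(\mathbb{R},\mathbb{M}^2)$. Additionally, $(A,\dot A)\in C^0(\mathbb{R},\mathcal{D})$.
   Context: $\mathbb{M}^2$ is the space of real $2\times2$ matrices with inner product $\langle A,B\rangle=\mathrm{tr}(A^\top B)$ and norm $|A|=\langle A,A\rangle^{1/2}$. $\mathrm{SL}(2,\mathbb{R})=\{A\in\mathbb{M}^2:\det A=1\}$. $Z=\begin{bmatrix}0&-1\\1&0\end{bmatrix}$ and $\mathrm{cof}\,A=ZAZ^\top$ is the cofactor matrix. The tangent space at $A\in\mathrm{SL}(2,\mathbb{R})$ is $T_A\mathrm{SL}(2,\mathbb{R})=\{B\in\mathbb{M}^2:\langle B,\mathrm{cof}\,A\rangle=0\}$, and the tangent bundle is $\mathcal{D}=\{(A,B)\in\mathbb{M}^2\times\mathbb{M}^2:A\in\mathrm{SL}(2,\mathbb{R}),\ B\in T_A\mathrm{SL}(2,\mathbb{R})\}$. The Lagrange multiplier map is $$\Lambda(A,B)=\frac{2(\kappa-\det B)}{|A|^2}.$$ *)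

(* Defs.v *)
From mathcomp Require Import all_boot all_order all_algebra.
From mathcomp Require Import all_classical all_reals all_analysis.
Import Order.TTheory GRing.Theory Num.Theory.
Import numFieldNormedType.Exports.

Set Implicit Arguments.
Unset Strict Implicit.
Unset Printing Implicit Defensive.

Local Open Scope classical_set_scope.
Local Open Scope ring_scope.

Definition inner (R : realType) (A B : 'M[R]_2) : R := \tr (A^T *m B).

(* The norm `|A| that 'M[R]_2 carries in the library is the maximum of the
   absolute values of the entries. The norm in the definition of Lambda is the
   Euclidean one below; both induce the same topology on 'M[R]_2. *)
Definition fnorm (R : realType) (A : 'M[R]_2) : R := Num.sqrt (inner A A).

Definition Z (R : realType) : 'M[R]_2 := delta_mx 1 0 - delta_mx 0 1.

Definition cof (R : realType) (A : 'M[R]_2) : 'M[R]_2 := Z R *m A *m (Z R)^T.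

Definition SL2 (R : realType) : set 'M[R]_2 := [set A | \det A = 1].

Definition tangent_space (R : realType) (A : 'M[R]_2) : set 'M[R]_2 :=
  [set B | inner B (cof A) = 0].

Definition tangent_bundle (R : realType) : set ('M[R]_2 * 'M[R]_2) :=
  [set X | SL2 X.1 /\ tangent_space X.1 X.2].

Definition Lambda (R : realType) (kappa : R) (A B : 'M[R]_2) : R :=
  2 * (kappa - \det B) / fnorm A ^+ 2.

(* Continuity into S with the subspace topology is continuity into V together
   with values in S. *)
Definition C0 (R : realType) (V : topologicalType) (S : set V) :
    set (R -> V) :=
  [set f : R -> V | continuous f /\ forall t, S (f t)].

Definition C2 (R : realType) (V : normedModType R) : set (R -> V) :=
  [set f : R -> V | [/\ forall t : R, derivable f t 1,
                        forall t : R, derivable (derive1 f) t 1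
                      & continuous (derive1 (derive1 f))]].

Definition solution (R : realType) (kappa : R) (A0 B0 : 'M[R]_2) :
    set (R -> 'M[R]_2) :=
  [set A : R -> 'M[R]_2 |
    [/\ C0 (@SL2 R) A,
        C2 A,
        forall t, derive1 (derive1 A) t + kappa *: A t =
                  Lambda kappa (A t) (derive1 A t) *: cof (A t)
      & (A 0, derive1 A 0) = (A0, B0)]].

(* Main.v *)
Require Import Defs.
From mathcomp Require Import all_boot all_order all_algebra.
From mathcomp Require Import all_classical all_reals all_analysis.
From mathcomp Require Import ring lra.
Import Order.TTheory GRing.Theory Num.Theory.
Import numFieldNormedType.Exports.

(** Replace the equation by A'' = L(A, A') cof A - kappa A, a second order
equation whose right-hand side is globally Lipschitz and coincides with the
original one on the states that a solution can reach. With B = A', |.| the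
Euclidean norm and c any constant larger than |B0|^2 + kappa |A0|^2, the
multiplier becomes
L(A, B) = 2 (kappa - d(B)) / max(2, |A|^2),  d(B) = det B * c / max(c, |B|^2).
The term L(A, B) cof A is built by products and differences from the functions
M_ij / r(M) and 1 / r(M), where r(M)^2 = max(2, |M|^2) for M = A and
r(M)^2 = max(c, |M|^2) for M = B; these are bounded and Lipschitz, and such
functions form an algebra. A Picard iteration then gives a solution on the
whole line ([picard_lindelof_global]), unique by Gronwall ([ode_unique]).

The modified solution solves the original equation because no cut-off is ever
active. Put g = det A - 1, p = <B, cof A> and e = |B|^2 + kappa |A|^2 - E0,
where E0 is the initial energy. Then g' = p and e' = 2 L p, while p' equals
- 2 kappa g up to the two cut-off errors, bounded by |e| (since |B|^2 > c >= E0
forces |B|^2 - c <= e) and by a multiple of |g| (since |A|^2 >= 2 det A). Hence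
h = g^2 + p^2 + e^2 satisfies |h'| <= C h with h(0) = 0, so h vanishes
identically ([cut_solution_invariants]). This gives det A = 1, so |A|^2 >= 2,
the tangency of B, and |B|^2 <= E0.

Conversely a solution of the original problem has det A = 1, hence p = 0, hence
constant energy, so it solves the modified equation ([solution_cut_field]) and
uniqueness carries over. *)

Set Implicit Arguments.
Unset Strict Implicit.
Unset Printing Implicit Defensive.

Local Open Scope classical_set_scope.
Local Open Scope ring_scope.

(** * Derivatives and primitives of functions of a real variable *)

Lemma is_derive_continuous (R : realType) (V : normedModType R) (f : R -> V)
    (t : R) (df : V) : is_derive t (1 : R) f df -> {for t, continuous f}.
Proof. by move=> [/derivable1_diffP/differentiable_continuous]. Qed.

Lemma is_derive_reflect (R : realType) (V : normedModType R) (f : R -> V)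
    (t : R) (df : V) :
  is_derive (- t) (1 : R) f df -> is_derive t (1 : R) (fun s => f (- s)) (- df).
Proof.
move=> [/derivable1_diffP fd fE].
have cd : is_diff t (f \o -%R) ('d f (- t) \o -%R).
  have fD : is_diff (- t) f ('d f (- t)) by exact: differentiableP.
  exact: is_diff_comp.
have dif : differentiable (f \o -%R) t by exact: ex_diff.
apply: DeriveDef; first exact/derivable1_diffP.
by rewrite deriveE// diff_val/= linearN -deriveE// fE.
Qed.

Lemma nondecreasing_is_derive (R : realType) (f df : R -> R) (a b : R) :
  (forall t, is_derive t (1 : R) f (df t)) ->
  (forall t, a <= t <= b -> 0 <= df t) -> a <= b -> f a <= f b.
Proof.
move=> fd df0 ab.
have [|c cab E] := @MVT_segment _ f df a b ab (fun x _ => fd x).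
  apply: continuous_subspaceT => x.
  exact: is_derive_continuous.
by rewrite -subr_ge0 E mulr_ge0 ?subr_ge0// df0.
Qed.

(** Vanishing on the negative half-line makes g integrable on every interval
unbounded below, so t |-> \int_(s <= t) g s is defined, and differentiable at
every t. *)
Lemma continuous_primitive_vanishing (R : realType) (g : R -> R) :
  continuous g -> (forall t, t <= 0 -> g t = 0) ->
  exists G : R -> R, forall t, is_derive t (1 : R) G (g t).
Proof.
move=> cg g0.
exists (fun t => \int[@lebesgue_measure R]_(s in `]-oo, t]) g s) => t.
have gint u : (@lebesgue_measure R).-integrable `]-oo, u] (EFin \o g).
  have mg : measurable_fun setT g.
    by apply: measurable_realfun.continuous_measurable_fun.
  have gi : (@lebesgue_measure R).-integrable `[0, u] (EFin \o g).
    apply: continuous_compact_integrable; first exact: segment_compact.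
    exact: continuous_subspaceT.
  apply/integrable_mkcond => //.
  have -> : (EFin \o g) \_ `]-oo, u] = (EFin \o g) \_ `[0, u].
    apply/funext => x; rewrite !patchE; case: ifPn => xu; case: ifPn => // xu'.
    - move: xu xu'.
      rewrite inE/= notin_setE/= !in_itv/= => xu; rewrite xu andbT.
      by move=> /negP; rewrite -ltNge => /ltW/g0 /= ->.
    - exfalso; move: xu xu'.
      by rewrite inE/= notin_setE/= !in_itv/= => xu /andP[_].
  by apply: (integrable_mkcond _ _).1 => //.
have tu : t < t + 1 by rewrite ltrDl.
have [d1 d2] := @continuous_FTC1 _ _ -oo%O _ _ tu (gint _) (ltNyr _) (cg t).
by apply: DeriveDef => //; rewrite -derive1E.
Qed.

(** Splitting f at 0, as the sum of f 0, of f (max 0 t) - f 0 and of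
f (min 0 t) - f 0, reduces a two-sided primitive to the one-sided case; the last
summand is reflected. *)
Lemma continuous_primitive (R : realType) (f : R -> R) (a : R) : continuous f ->
  exists F : R -> R, F 0 = a /\ forall t, is_derive t (1 : R) F (f t).
Proof.
move=> cf.
have cR (h : R -> R) : continuous h -> continuous (fun t => f (h t) - f 0).
  move=> ch t; apply: cvgB; last exact: cvg_cst.
  by apply: continuous_comp; [exact: ch|exact: cf].
have [|t t0|F1 dF1] :=
    @continuous_primitive_vanishing R (fun t => f (Num.max 0 t) - f 0).
- apply: (cR (fun t => Num.max 0 t)) => t.
  by apply: continuous_max; [exact: cvg_cst|exact: cvg_id].
- by rewrite max_l// subrr.
have [|t t0|F2 dF2] :=
    @continuous_primitive_vanishing R (fun t => f (Num.min 0 (- t)) - f 0).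
- apply: (cR (fun t => Num.min 0 (- t))) => t.
  by apply: continuous_min; [exact: cvg_cst|exact: continuousN].
- by rewrite min_l ?subrr// oppr_ge0.
pose G t := f 0 * t + F1 t - F2 (- t).
have dG t : is_derive t (1 : R) G (f t).
  have d2 := is_derive_reflect (dF2 (- t)).
  have d1 := dF1 t.
  have d0 : is_derive t (1 : R) (fun t => f 0 * t) (f 0).
    apply: is_derive_eq; by rewrite /GRing.scale/= mulr1.
  apply: (@is_derive_eq _ _ _ _ _ _ _ _ (is_deriveB (is_deriveD d0 d1) d2)).
  by rewrite !opprK; case: leP => _; ring.
exists (fun t => G t + (a - G 0)); split; first by rewrite addrC subrK.
move=> t; have := is_deriveD (dG t) (is_derive_cst (a - G 0) t 1).
by rewrite addr0.
Qed.

(** * Matrix-valued functions *)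

Lemma ler_entry_norm (R : realType) (m n : nat) (M : 'M[R]_(m, n)) i j :
  `|M i j| <= `|M|.
Proof.
by rewrite [leRHS]/Num.Def.normr/= mx_normrE; exact: (le_bigmax _ _ (i, j)).
Qed.

Lemma ler_norm_entries (R : realType) (m n : nat) (M : 'M[R]_(m, n)) (c : R) :
  0 <= c -> (forall i j, `|M i j| <= c) -> `|M| <= c.
Proof.
by move=> c0 Mc; rewrite /Num.Def.normr/= mx_normrE (bigmax_le _ c0).
Qed.

Lemma is_derive_mxP (R : realType) (m n : nat) (y : R -> 'M[R]_(m, n)) (t : R)
    (D : 'M[R]_(m, n)) :
  is_derive t (1 : R) y D <->
  forall i j, is_derive t (1 : R) (fun s => y s i j) (D i j).
Proof.
split=> [[yd yD] i j|yd].
  apply: DeriveDef; first exact: (derivable_mxP _ _ _).1.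
  by rewrite -yD derive_mx// mxE.
have yt : derivable y t 1 by apply/derivable_mxP => i j; exact: ex_derive.
apply: DeriveDef => //.
by rewrite derive_mx//; apply/matrixP => i j; rewrite mxE derive_val.
Qed.

Lemma continuous_primitive_mx (R : realType) (m n : nat) (f : R -> 'M[R]_(m, n))
    (M : 'M[R]_(m, n)) : continuous f ->
  exists Y : R -> 'M[R]_(m, n),
    Y 0 = M /\ forall t, is_derive t (1 : R) Y (f t).
Proof.
move=> cf.
have /choice[Y YP] (ij : 'I_m * 'I_n) : exists Yij : R -> R,
    Yij 0 = M ij.1 ij.2 /\ forall t, is_derive t (1 : R) Yij (f t ij.1 ij.2).
  apply: continuous_primitive => t.
  apply: (@continuous_comp _ _ _ f (fun N : 'M[R]_(m, n) => N ij.1 ij.2)).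
    exact: cf.
  exact: coord_continuous.
exists (fun t => \matrix_(i, j) Y (i, j) t); split.
  by apply/matrixP => i j; rewrite mxE (YP (i, j)).1.
move=> t; apply/is_derive_mxP => i j.
rewrite (_ : (fun _ => _) = Y (i, j)); first exact: (YP (i, j)).2.
by apply/funext => s; rewrite mxE.
Qed.

(** * Growth and Gronwall estimates *)

Lemma is_derive_expR_scale (R : realType) (c a t : R) :
  is_derive t (1 : R) (fun s => c * expR (a * s)) (c * a * expR (a * t)).
Proof.
have d1 : is_derive t (1 : R) (fun s => a * s) a.
  by apply: is_derive_eq; rewrite /GRing.scale/= mulr1.
have d2 : is_derive t (1 : R) (fun s => expR (a * s)) (a * expR (a * t)).
  have := @is_derive1_comp R expR (fun s => a * s) t _ _ (is_derive_expR _) d1.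
  by rewrite /GRing.scale/= mulrC.
by apply: is_derive_eq; rewrite /GRing.scale/= mulrA.
Qed.

Lemma is_derive_growth_right (R : realType) (f df : R -> R) (c a t : R) :
  0 <= c -> 0 <= t ->
  (forall s, is_derive s (1 : R) f (df s)) ->
  (forall s, 0 <= s -> df s <= c * a * expR (a * s)) ->
  f t - f 0 <= c * expR (a * t).
Proof.
move=> c0 t0 fd dfle.
have := @nondecreasing_is_derive R (fun s => c * expR (a * s) - f s)
  (fun s => c * a * expR (a * s) - df s) 0 t
  (fun s => is_deriveB (is_derive_expR_scale c a s) (fd s)) _ t0.
rewrite mulr0 expR0 mulr1 => H.
suff : c - f 0 <= c * expR (a * t) - f t by lra.
by apply: H => s /andP[s0 _]; rewrite subr_ge0 dfle.
Qed.

(** The weight exp (a |t|) is the one of Bielecki's norm: integrating a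
function of weighted size c * a gains the factor a^-1. *)
Lemma is_derive_growth (R : realType) (f df : R -> R) (c a t : R) :
  0 <= c ->
  (forall s, is_derive s (1 : R) f (df s)) ->
  (forall s, `|df s| <= c * a * expR (a * `|s|)) ->
  `|f t - f 0| <= c * expR (a * `|t|).
Proof.
move=> c0.
have right (g dg : R -> R) (s : R) : 0 <= s ->
    (forall s, is_derive s (1 : R) g (dg s)) ->
    (forall s, `|dg s| <= c * a * expR (a * `|s|)) ->
    `|g s - g 0| <= c * expR (a * `|s|).
  move=> s0 gd dgle; rewrite (ger0_norm s0) ler_norml; apply/andP; split.
    have := @is_derive_growth_right R (- g) (fun s => - dg s) c a s c0 s0
      (fun s => is_deriveN (gd s)).
    rewrite !opprfctE => H; suff : - g s - - g 0 <= c * expR (a * s) by lra.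
    apply: H => r r0; have := dgle r; rewrite (ger0_norm r0) => H.
    by rewrite (le_trans _ H)// -normrN ler_norm.
  apply: (is_derive_growth_right (df := dg)) => // r r0; have := dgle r.
  by rewrite (ger0_norm r0); apply: le_trans; rewrite ler_norm.
move=> fd dfle; have [t0|t0] := leP 0 t; first exact: (right f df).
have := right (fun s => f (- s)) (fun s => - df (- s)) (- t).
rewrite opprK oppr0 normrN; apply.
- by rewrite oppr_ge0 ltW.
- by move=> s; apply: is_derive_reflect.
- by move=> s; rewrite normrN -[`|s|]normrN.
Qed.

Lemma is_derive_growth_mx (R : realType) (m n : nat) (y dy : R -> 'M[R]_(m, n))
    (c a t : R) : 0 <= c ->
  (forall s, is_derive s (1 : R) y (dy s)) ->
  (forall s, `|dy s| <= c * a * expR (a * `|s|)) ->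
  `|y t - y 0| <= c * expR (a * `|t|).
Proof.
move=> c0 yd dyle; apply: ler_norm_entries => [|i j].
  by rewrite mulr_ge0 ?expR_ge0.
rewrite !mxE.
apply: (@is_derive_growth _ (fun s => y s i j) (fun s => dy s i j)) => // s.
  exact: (is_derive_mxP _ _ _).1.
by apply: le_trans (dyle s); exact: ler_entry_norm.
Qed.

(** Gronwall's lemma with zero initial value, in both time directions. *)
Lemma gronwall0 (R : realType) (h dh : R -> R) (C : R) :
  (forall t, is_derive t (1 : R) h (dh t)) -> (forall t, 0 <= h t) -> h 0 = 0 ->
  (forall t, `|dh t| <= C * h t) -> forall t, h t = 0.
Proof.
have right (g dg : R -> R) (s : R) : 0 <= s ->
    (forall t, is_derive t (1 : R) g (dg t)) ->
    (forall t, 0 <= g t) -> g 0 = 0 ->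
    (forall t, `|dg t| <= C * g t) -> g s = 0.
  move=> s0 gd g0 g00 dgle.
  pose u t := g t * (1 * expR (- C * t)).
  pose du t := expR (- C * t) * (dg t - C * g t).
  have ud t : is_derive t (1 : R) (- u) (- du t).
    apply: is_deriveN.
    apply: (@is_derive_eq _ _ _ _ _ _ _ _
      (is_deriveM (gd t) (is_derive_expR_scale 1 (- C) t))).
    by rewrite /du /GRing.scale/=; ring.
  have : (- u) 0 <= (- u) s.
    apply: (nondecreasing_is_derive (f := - u) (df := fun t => - du t)) => //.
    move=> t _.
    rewrite oppr_ge0 /du mulr_ge0_le0 ?expR_ge0// subr_le0.
    by apply: le_trans (dgle t); rewrite ler_norm.
  rewrite !opprfctE /u g00 mul0r oppr0 oppr_ge0 mul1r => us0.
  apply/eqP; rewrite eq_le g0 andbT.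
  by rewrite -(pmulr_lle0 _ (expR_gt0 (- C * s))).
move=> hd h0 h00 dhle t; have [t0|t0] := leP 0 t; first exact: (right h dh).
have := right (fun s => h (- s)) (fun s => - dh (- s)) (- t).
rewrite opprK oppr0; apply => //.
- by rewrite oppr_ge0 ltW.
- by move=> s; apply: is_derive_reflect.
- by move=> s; rewrite normrN.
Qed.

(** * Global solutions of Lipschitz differential equations *)

Lemma lipschitz_continuous (R : realType) (V W : normedModType R) (k : R)
    (F : V -> W) : (forall x y, `|F x - F y| <= k * `|x - y|) -> continuous F.
Proof.
move=> Flip x; apply/cvgrPdist_lt => e e0.
near=> y; apply: (le_lt_trans (Flip x y)).
apply: (@le_lt_trans _ _ ((`|k| + 1) * `|x - y|)).
  by rewrite ler_wpM2r// (le_trans (ler_norm _))// lerDl.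
rewrite mulrC -ltr_pdivlMr ?ltr_wpDl//.
by near: y; apply: cvgr_dist_lt; rewrite ?divr_gt0 ?ltr_wpDl.
Unshelve. all: by end_near. Qed.

Lemma half_pow_small (R : realType) (C e : R) : 0 < e ->
  exists n, C * 2^-1 ^+ n < e.
Proof.
move=> e0.
have h : `|2^-1 : R| < 1 by rewrite gtr0_norm ?invr_gt0// invf_lt1// ltr1n.
have : (fun n => C * 2^-1 ^+ n) @ \oo --> C * (0 : R).
  by apply: cvgMr; exact: cvg_expr.
rewrite mulr0 => /cvgrPdist_lt/(_ e e0)[N _ /(_ N (leqnn N))] /=.
by rewrite sub0r normrN => H; exists N; exact: (le_lt_trans (ler_norm _)).
Qed.

(** A globally Lipschitz autonomous equation has a solution on the whole line
through every initial value. With the weight exp (2 l |t|), where l >= 1 bounds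
the Lipschitz constant, each Picard iteration halves the distance of
consecutive iterates, so they converge locally uniformly; the limit z equals
the primitive of F \o z. *)
Lemma picard_lindelof_global (R : realType) (m n : nat)
    (F : 'M[R]_(m, n) -> 'M[R]_(m, n)) (k : R) (x0 : 'M[R]_(m, n)) :
  (forall x y, `|F x - F y| <= k * `|x - y|) ->
  exists y : R -> 'M[R]_(m, n),
    y 0 = x0 /\ forall t, is_derive t (1 : R) y (F (y t)).
Proof.
move=> Flip0.
pose l : R := Num.max k 1.
have l1 : 1 <= l by rewrite le_max lexx orbT.
have Flip x y : `|F x - F y| <= l * `|x - y|.
  by apply: (le_trans (Flip0 x y)); rewrite ler_wpM2r// le_max lexx.
have cF : continuous F by exact: lipschitz_continuous Flip.
(* P f is the primitive of a continuous f with value x0 at 0. *)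
have /choice[P PP] (f : R -> 'M[R]_(m, n)) : exists Y : R -> 'M[R]_(m, n),
    continuous f -> Y 0 = x0 /\ forall t, is_derive t (1 : R) Y (f t).
  have [cf|ncf] := pselect (continuous f); last by exists f.
  by have [Y YP] := continuous_primitive_mx x0 cf; exists Y.
(* The Picard iterates. *)
pose y j := iter j (fun f => P (F \o f)) (cst x0).
have cFf (f : R -> 'M[R]_(m, n)) : continuous f -> continuous (F \o f).
  by move=> cf t; apply: continuous_comp; [exact: cf|exact: cF].
have cy j : continuous (y j).
  elim: j => [|j IH] t; first exact: cvg_cst.
  exact: (is_derive_continuous ((PP _ (cFf _ IH)).2 t)).
have y0 j : y j 0 = x0.
  by case: j => [|j] //=; apply: (PP _ (cFf _ (cy j))).1.
have dy j (t : R) : is_derive t (1 : R) (y j.+1) (F (y j t)).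
  exact: (PP _ (cFf _ (cy j))).2.
have y00 t : y 0%N t = x0 by [].
clearbody y.
pose K := `|F x0|; have K0 : 0 <= K by exact: normr_ge0.
pose w (t : R) := expR (2 * l * `|t|).
have w0 (t : R) : 0 <= w t by exact: expR_ge0.
have step j (t : R) : `|y j.+1 t - y j t| <= K * 2^-1 ^+ j * w t.
  elim: j t => [|j IH] t.
    rewrite expr0 mulr1 y00 -[X in y 1%N t - X](y0 1%N).
    apply: (@is_derive_growth_mx R m n _ _ K (2 * l) t K0 (dy 0%N)) => // s.
    rewrite y00 -/K -/(w s) -mulrA ler_peMr//.
    have : 1 <= w s by rewrite -expR0 ler_expR !mulr_ge0//; lra.
    nra.
  rewrite -[X in `|X|]subr0 -[X in _ - _ - X](subrr x0).
  rewrite -{1}(y0 j.+2) -(y0 j.+1).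
  apply: (@is_derive_growth_mx R m n (y j.+2 - y j.+1)
    (fun s => F (y j.+1 s) - F (y j s)) (K * 2^-1 ^+ j.+1) (2 * l) t _
    (fun s => is_deriveB (dy j.+1 s) (dy j s))).
    by rewrite mulr_ge0// exprn_ge0// invr_ge0.
  move=> s; apply: (le_trans (Flip _ _)).
  rewrite [leRHS](_ : _ = l * (K * 2^-1 ^+ j * w s)).
    by rewrite ler_wpM2l//; lra.
  by rewrite exprS /w; field.
(* Summing the geometric series of the steps. *)
have far j i (t : R) : `|y (j + i)%N t - y j t| <= K * 2^-1 ^+ j * w t * 2.
  suff : `|y (j + i)%N t - y j t| <= K * 2^-1 ^+ j * w t * (2 - 2 * 2^-1 ^+ i).
    move/le_trans; apply; rewrite ler_wpM2l//.
      by rewrite !mulr_ge0// exprn_ge0// invr_ge0.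
    by rewrite gerBl mulr_ge0// exprn_ge0// invr_ge0.
  elim: i => [|i IH].
    by rewrite addn0 subrr normr0 expr0 mulr1 subrr mulr0.
  rewrite addnS -(subrKA (y (j + i)%N t)); apply: (le_trans (ler_normD _ _)).
  apply: (le_trans (lerD (step _ _) IH)).
  by rewrite exprD exprS le_eqVlt; apply/orP; left; apply/eqP; field.
have cvgy (t : R) : cvgn (fun j => y j t).
  apply/cauchy_cvgP; apply: cauchy_exP => e e0.
  have [N NP] := half_pow_small (K * w t * 2) e0.
  exists (y N t); exists N => // j /= Nj; rewrite -ball_normE /=.
  rewrite distrC -(subnKC Nj); apply: (le_lt_trans (far _ _ _)).
  by rewrite (_ : _ * _ = K * w t * 2 * 2^-1 ^+ N)//; ring.
pose z (t : R) := limn (fun j => y j t).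
have yz j (t : R) : `|z t - y j t| <= K * 2^-1 ^+ j * w t * 2.
  apply/ler_addgt0Pr => e e0.
  have /cvgrPdist_lt/(_ e e0)[N _ NP] := cvgy t.
  have := NP (j + N)%N (leq_addl _ _) => /= /ltW H.
  rewrite -(subrKA (y (j + N)%N t)); apply: (le_trans (ler_normD _ _)).
  by rewrite addrC lerD.
have cz : continuous z.
  move=> t; apply/cvgrPdist_lt => e e0.
  pose W := expR (2 * l * (`|t| + 1)).
  have [N NP] : exists N, K * W * 2 * 2^-1 ^+ N < e / 3.
    by apply: half_pow_small; lra.
  have near_z (s : R) : `|s| <= `|t| + 1 -> `|z s - y N s| < e / 3.
    move=> st; apply: le_lt_trans NP; apply: (le_trans (yz N s)).
    rewrite [leRHS](_ : _ = K * 2^-1 ^+ N * W * 2); last by ring.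
    rewrite ler_wpM2r// ler_wpM2l//.
      by rewrite mulr_ge0// exprn_ge0// invr_ge0.
    by rewrite ler_expR ler_wpM2l//; lra.
  near=> s.
  have st : `|s| <= `|t| + 1.
    have ts : `|t - s| < 1 by near: s; apply: cvgr_dist_lt.
    by have := ler_normB t (t - s); rewrite subKr; lra.
  have h1 : `|z t - y N t| < e / 3 by apply: near_z; rewrite lerDl.
  have h2 := near_z s st.
  have h3 : `|y N t - y N s| < e / 3.
    by near: s; apply: cvgr_dist_lt; [exact: cy|lra].
  rewrite (_ : z t - z s = (z t - y N t) + (y N t - y N s) - (z s - y N s)).
    apply: (le_lt_trans (ler_normB _ _)).
    have := ler_normD (z t - y N t) (y N t - y N s); lra.
  by rewrite subrKA opprB subrKA.
have [v0 dv] := PP _ (cFf _ cz).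
(* Both sides are limits of the iterates, the left one by the growth
   estimate. *)
have vz : P (F \o z) = z.
  apply/funext => t; apply/eqP; rewrite -subr_eq0 -normr_le0.
  apply/ler_addgt0Pr => e e0; rewrite add0r.
  have [j jP] := half_pow_small (K * w t * 2) e0.
  apply: ltW; apply: le_lt_trans jP.
  have h1 : `|P (F \o z) t - y j.+1 t| <= K * 2^-1 ^+ j * w t.
    rewrite -[X in `|X|]subr0 -[X in _ - _ - X](subrr x0) -{1}v0 -(y0 j.+1).
    apply: (@is_derive_growth_mx R m n (P (F \o z) - y j.+1)
      (fun s => F (z s) - F (y j s)) (K * 2^-1 ^+ j) (2 * l) t _
      (fun s => is_deriveB (dv s) (dy j s))).
      by rewrite mulr_ge0// exprn_ge0// invr_ge0.
    move=> s; apply: (le_trans (Flip _ _)).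
    rewrite [leRHS](_ : _ = l * (K * 2^-1 ^+ j * w s * 2)).
      by rewrite ler_wpM2l//; lra.
    by rewrite /w; ring.
  have h2 := yz j.+1 t; rewrite -(subrKA (y j.+1 t)).
  rewrite -[X in _ + X]opprB; apply: (le_trans (ler_normB _ _)).
  apply: (le_trans (lerD h1 h2)); rewrite exprS le_eqVlt; apply/orP; left.
  by apply/eqP; field.
by exists z; rewrite -vz; split => // t; rewrite {2}vz; exact: dv.
Unshelve. all: by end_near. Qed.

Lemma is_derive_mul (R : realType) (f g : R -> R) (t df dg : R) :
  is_derive t (1 : R) f df -> is_derive t (1 : R) g dg ->
  is_derive t (1 : R) (fun s => f s * g s) (f t * dg + g t * df).
Proof. by move=> fd gd; exact: (is_deriveM fd gd). Qed.

Lemma is_derive_sqr (R : realType) (f : R -> R) (t df : R) :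
  is_derive t (1 : R) f df ->
  is_derive t (1 : R) (fun s => f s ^+ 2) (2 * f t * df).
Proof.
move=> fd; rewrite (_ : (fun _ => _) = (fun s => f s * f s)); last first.
  by apply/funext => s; rewrite expr2.
by apply: (is_derive_eq (is_derive_mul fd fd)); ring.
Qed.

(** The sum h of the squared entries of y1 - y2 satisfies |h'| <= C h. *)
Lemma ode_unique (R : realType) (m n : nat)
    (F : 'M[R]_(m, n) -> 'M[R]_(m, n)) (k : R) (y1 y2 : R -> 'M[R]_(m, n)) :
  (forall x y, `|F x - F y| <= k * `|x - y|) -> y1 0 = y2 0 ->
  (forall t, is_derive t (1 : R) y1 (F (y1 t))) ->
  (forall t, is_derive t (1 : R) y2 (F (y2 t))) -> y1 = y2.
Proof.
move=> Flip0 y120 d1 d2.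
pose l : R := Num.max k 0.
have l0 : 0 <= l by rewrite le_max lexx orbT.
have Flip x y : `|F x - F y| <= l * `|x - y|.
  by apply: (le_trans (Flip0 x y)); rewrite ler_wpM2r// le_max lexx.
pose d (t : R) i j := y1 t i j - y2 t i j.
pose dd (t : R) i j := F (y1 t) i j - F (y2 t) i j.
pose h := \sum_(i < m) \sum_(j < n) (fun t : R => d t i j ^+ 2).
have hE t : h t = \sum_(i < m) \sum_(j < n) d t i j ^+ 2.
  by rewrite /h fct_sumE; apply: eq_bigr => i _; rewrite fct_sumE.
have hd t : is_derive t (1 : R) h
    (\sum_(i < m) \sum_(j < n) 2 * d t i j * dd t i j).
  apply: is_derive_sum => i; apply: is_derive_sum => j.
  have dij := is_deriveB ((is_derive_mxP _ _ _).1 (d1 t) i j)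
    ((is_derive_mxP _ _ _).1 (d2 t) i j).
  exact: (is_derive_sqr dij).
have h0 t : 0 <= h t.
  by rewrite hE; apply: sumr_ge0 => i _; apply: sumr_ge0 => j _; exact: sqr_ge0.
have dle t i j : `|d t i j| <= Num.sqrt (h t).
  rewrite -sqrtr_sqr ler_wsqrtr// hE (bigD1 i)//= (bigD1 j)//= -addrA lerDl.
  rewrite addr_ge0//; first by apply: sumr_ge0 => ? _; exact: sqr_ge0.
  by apply: sumr_ge0 => ? _; apply: sumr_ge0 => ? _; exact: sqr_ge0.
have Dle t : `|y1 t - y2 t| <= Num.sqrt (h t).
  apply: ler_norm_entries => [|i j]; first exact: sqrtr_ge0.
  by rewrite !mxE dle.
have ddle t i j : `|dd t i j| <= l * Num.sqrt (h t).
  have := ler_entry_norm (F (y1 t) - F (y2 t)) i j; rewrite !mxE => /le_trans.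
  by apply; apply: (le_trans (Flip _ _)); rewrite ler_wpM2l.
have hz : forall t, h t = 0.
  apply: (gronwall0 (C := 2 * l *+ n *+ m) hd h0).
    rewrite hE big1// => i _; rewrite big1// => j _.
    by rewrite /d y120 subrr expr0n.
  move=> t; rewrite [leRHS](_ : _ = \sum_(i < m) \sum_(j < n) 2 * l * h t).
    apply: (le_trans (ler_norm_sum _ _ _)); apply: ler_sum => i _.
    apply: (le_trans (ler_norm_sum _ _ _)); apply: ler_sum => j _.
    rewrite !normrM (gtr0_norm (ltr0n _ 2)) -mulrA -mulrA ler_pM2l//.
    have E : h t = Num.sqrt (h t) * Num.sqrt (h t) by rewrite -expr2 sqr_sqrtr.
    by rewrite E mulrCA ler_pM.
  by rewrite !sumr_const !card_ord !mulrnAl.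
apply/funext => t; apply/matrixP => i j; apply/eqP.
rewrite -subr_eq0 -normr_le0.
by have := dle t i j; rewrite hz sqrtr0.
Qed.

(** * Two by two matrices *)

Lemma forall_ord2 (P : 'I_2 -> Prop) : P 0 -> P 1 -> forall i, P i.
Proof.
move=> P0 P1 [[|[|//]] lti].
  by rewrite (_ : Ordinal lti = 0)//; exact/val_inj.
by rewrite (_ : Ordinal lti = 1)//; exact/val_inj.
Qed.

Lemma sum_ord2 (V : nmodType) (f : 'I_2 -> V) : \sum_(i < 2) f i = f 0 + f 1.
Proof.
rewrite !big_ord_recl big_ord0 addr0; congr (_ + f _); exact/val_inj.
Qed.

Lemma det_mx2 (R : comNzRingType) (A : 'M[R]_2) :
  \det A = A 0 0 * A 1 1 - A 0 1 * A 1 0.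
Proof.
rewrite (expand_det_row A 0) sum_ord2 /cofactor !det_mx11 !mxE /= expr0 expr1.
rewrite (_ : lift 0 0 = 1); last exact/val_inj.
rewrite (_ : lift 1 0 = 0); last exact/val_inj.
by rewrite mul1r mulN1r mulrN.
Qed.

Lemma inner2E (R : realType) (A B : 'M[R]_2) :
  inner A B = A 0 0 * B 0 0 + A 0 1 * B 0 1 + A 1 0 * B 1 0 + A 1 1 * B 1 1.
Proof. rewrite /inner /mxtrace sum_ord2 !mxE !sum_ord2 !mxE; ring. Qed.

Lemma cof2E (R : realType) (A : 'M[R]_2) :
  (cof A 0 0 = A 1 1) * (cof A 0 1 = - A 1 0) *
  (cof A 1 0 = - A 0 1) * (cof A 1 1 = A 0 0).
Proof.
by rewrite /cof /Z !mxE !sum_ord2 !mxE !sum_ord2 !mxE /=; do !split; ring.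
Qed.

Lemma inner_cof (R : realType) (A : 'M[R]_2) : inner A (cof A) = 2 * \det A.
Proof. by rewrite inner2E !cof2E det_mx2; ring. Qed.

Lemma inner_ge2det (R : realType) (A : 'M[R]_2) : 2 * `|\det A| <= inner A A.
Proof.
rewrite det_mx2 inner2E.
have h1 := sqr_ge0 (A 0 0 - A 1 1); have h2 := sqr_ge0 (A 0 0 + A 1 1).
have h3 := sqr_ge0 (A 0 1 - A 1 0); have h4 := sqr_ge0 (A 0 1 + A 1 0).
suff : `|A 0 0 * A 1 1 - A 0 1 * A 1 0| <= 2^-1 * (A 0 0 * A 0 0 + A 0 1 * A 0 1
  + A 1 0 * A 1 0 + A 1 1 * A 1 1) by lra.
by rewrite ler_norml; apply/andP; split; lra.
Qed.

Lemma inner_ge0 (R : realType) (A : 'M[R]_2) : 0 <= inner A A.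
Proof. by apply: le_trans (inner_ge2det A); rewrite mulr_ge0. Qed.

(** * Bounded Lipschitz functions *)

(** Real functions that are both bounded and Lipschitz. A single constant
serves for both bounds. *)
Definition bounded_lipschitz (R : realType) (V : normedModType R)
    (f : V -> R) :=
  exists k : R, [/\ 0 <= k, forall x, `|f x| <= k
                  & forall x y, `|f x - f y| <= k * `|x - y|].

Section bounded_lipschitz_algebra.
Variables (R : realType) (V : normedModType R).
Implicit Types f g : V -> R.

Lemma bounded_lipschitz_cst (c : R) : bounded_lipschitz (fun _ : V => c).
Proof.
by exists `|c|; split=> // x y; rewrite subrr normr0 mulr_ge0.
Qed.

Lemma bounded_lipschitzB f g : bounded_lipschitz f -> bounded_lipschitz g ->
  bounded_lipschitz (fun x => f x - g x).
Proof.
move=> [k [k0 fk flip]] [l [l0 gl glip]]; exists (k + l); split.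
- exact: addr_ge0.
- by move=> x; apply: (le_trans (ler_normB _ _)); rewrite lerD.
- move=> x y; rewrite mulrDl.
  rewrite (_ : _ - _ = (f x - f y) - (g x - g y)); last by ring.
  by apply: (le_trans (ler_normB _ _)); rewrite lerD.
Qed.

Lemma bounded_lipschitzM f g : bounded_lipschitz f -> bounded_lipschitz g ->
  bounded_lipschitz (fun x => f x * g x).
Proof.
move=> [k [k0 fk flip]] [l [l0 gl glip]]; exists (2 * k * l); split.
- by rewrite !mulr_ge0.
- move=> x; rewrite normrM (le_trans (ler_pM _ _ (fk x) (gl x)))//.
  by rewrite ler_wpM2r//; lra.
- move=> x y.
  rewrite (_ : _ - _ = f x * (g x - g y) + (f x - f y) * g y); last by ring.
  apply: (le_trans (ler_normD _ _)); rewrite !normrM.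
  rewrite (_ : 2 * k * l * _ = k * (l * `|x - y|) + k * `|x - y| * l);
    last by ring.
  by rewrite lerD// ler_pM.
Qed.

Lemma bounded_lipschitz_comp (W : normedModType R) (p : W -> V) f :
  (forall x y, `|p x - p y| <= `|x - y|) -> bounded_lipschitz f ->
  bounded_lipschitz (fun x => f (p x)).
Proof.
move=> plip [k [k0 fk flip]]; exists k; split=> // x y.
by apply: (le_trans (flip _ _)); rewrite ler_wpM2l.
Qed.

End bounded_lipschitz_algebra.

Section cut_norm_theory.
Variables (R : realType) (c : R).
Hypothesis c0 : 0 < c.
Implicit Types A B : 'M[R]_2.

(** The Euclidean norm, truncated from below at the square root of c. *)
Definition cut_norm A : R := Num.sqrt (Num.max c (inner A A)).

Lemma sqr_cut_norm A : cut_norm A ^+ 2 = Num.max c (inner A A).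
Proof. by rewrite sqr_sqrtr// le_max (ltW c0). Qed.

Lemma cut_norm_gt0 A : 0 < cut_norm A.
Proof. by rewrite sqrtr_gt0 lt_max c0. Qed.

Lemma cut_norm_ge A : Num.sqrt c <= cut_norm A.
Proof. by rewrite ler_wsqrtr// le_max lexx. Qed.

Lemma ler_entry_cut_norm A i j : `|A i j| <= cut_norm A.
Proof.
rewrite -sqrtr_sqr ler_wsqrtr// le_max; apply/orP; right; rewrite inner2E.
have h := (sqr_ge0 (A 0 0), sqr_ge0 (A 0 1), sqr_ge0 (A 1 0), sqr_ge0 (A 1 1)).
move: i j; do 2 apply: forall_ord2; rewrite -!expr2; case: h => [[[]]]; lra.
Qed.

(** Multiply by the sum of the two norms and factor the differences of squared entries. *)
Lemma cut_norm_lipschitz A B : `|cut_norm A - cut_norm B| <= 4 * `|A - B|.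
Proof.
have s0 : 0 < cut_norm A + cut_norm B by rewrite addr_gt0// cut_norm_gt0.
rewrite -(ler_pM2r s0) -{1}(gtr0_norm s0) -normrM -subr_sqr !sqr_cut_norm.
apply: (@le_trans _ _ `|inner A A - inner B B|).
  rewrite /Num.max; case: ltP => h1; case: ltP => h2;
    rewrite ?subrr ?normr0//; rewrite !ler_norml;
    case: (lerP 0 (inner A A - inner B B)) => h3;
    rewrite ?(ger0_norm h3) ?(ltr0_norm h3); apply/andP; split; lra.
have e i j : `|A i j ^+ 2 - B i j ^+ 2| <= `|A - B| * (cut_norm A + cut_norm B).
  rewrite subr_sqr normrM ler_pM//.
    by have := ler_entry_norm (A - B) i j; rewrite !mxE.
  by rewrite (le_trans (ler_normD _ _))// lerD// ler_entry_cut_norm.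
rewrite !inner2E -!expr2.
rewrite (_ : _ - _ = (A 0 0 ^+ 2 - B 0 0 ^+ 2) + (A 0 1 ^+ 2 - B 0 1 ^+ 2)
  + (A 1 0 ^+ 2 - B 1 0 ^+ 2) + (A 1 1 ^+ 2 - B 1 1 ^+ 2)); last by ring.
rewrite (_ : 4 * _ * _ = `|A - B| * (cut_norm A + cut_norm B)
  + `|A - B| * (cut_norm A + cut_norm B) + `|A - B| * (cut_norm A + cut_norm B)
  + `|A - B| * (cut_norm A + cut_norm B)); last by ring.
by do 3 (apply: (le_trans (ler_normD _ _)); apply: lerD => //).
Qed.

Lemma bounded_lipschitz_inv_cut_norm :
  bounded_lipschitz (fun A => (cut_norm A)^-1).
Proof.
have r0 : 0 < Num.sqrt c by rewrite sqrtr_gt0.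
have inv_le A : `|(cut_norm A)^-1| <= (Num.sqrt c)^-1.
  rewrite gtr0_norm ?invr_gt0 ?cut_norm_gt0// lef_pV2 ?posrE ?cut_norm_gt0//.
  exact: cut_norm_ge.
exists ((Num.sqrt c)^-1 + 4 * (Num.sqrt c)^-1 ^+ 2).
have h1 : 0 <= (Num.sqrt c)^-1 by rewrite invr_ge0 ltW.
have h2 : 0 <= 4 * (Num.sqrt c)^-1 ^+ 2 by rewrite mulr_ge0// sqr_ge0.
split=> [|A|A B]; first exact: addr_ge0.
  by rewrite (le_trans (inv_le A))// lerDl.
have A0 := cut_norm_gt0 A; have B0 := cut_norm_gt0 B.
rewrite (_ : _ - _ = (cut_norm B - cut_norm A) *
  ((cut_norm A)^-1 * (cut_norm B)^-1)); last first.
  by field; rewrite !gt_eqF.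
rewrite [leRHS]mulrDl; apply: ler_wpDl; first exact: mulr_ge0.
rewrite 2!normrM distrC mulrAC ler_pM// ?cut_norm_lipschitz//.
by rewrite expr2 ler_pM.
Qed.

Lemma bounded_lipschitz_radial i j :
  bounded_lipschitz (fun A => A i j / cut_norm A).
Proof.
have r0 : 0 < Num.sqrt c by rewrite sqrtr_gt0.
have u1 A : `|A i j / cut_norm A| <= 1.
  rewrite normrM normfV (gtr0_norm (cut_norm_gt0 _)).
  by rewrite ler_pdivrMr ?cut_norm_gt0// mul1r ler_entry_cut_norm.
exists (1 + 5 / Num.sqrt c).
have h : 0 <= 5 / Num.sqrt c by rewrite divr_ge0// ltW.
split=> [|A|A B]; first exact: addr_ge0.
  by rewrite (le_trans (u1 A))// lerDl.
have A0 := cut_norm_gt0 A; have B0 := cut_norm_gt0 B.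
rewrite (_ : _ - _ = ((A i j - B i j) +
   B i j / cut_norm B * (cut_norm B - cut_norm A))
   / cut_norm A); last by field; rewrite !gt_eqF.
rewrite [leRHS]mulrDl mul1r; apply: ler_wpDl => //.
rewrite normrM normfV (gtr0_norm A0) [leRHS]mulrAC.
apply: ler_pM => //; [by rewrite invr_ge0 ltW| |]; last first.
  by rewrite lef_pV2 ?posrE// cut_norm_ge.
rewrite (_ : 5 * _ = `|A - B| + 1 * (4 * `|A - B|)); last by ring.
apply: (le_trans (ler_normD _ _)); apply: lerD.
  by have := ler_entry_norm (A - B) i j; rewrite !mxE.
by rewrite normrM ler_pM// distrC cut_norm_lipschitz.
Qed.

End cut_norm_theory.

Lemma lipschitz_entries (R : realType) (V : normedModType R) (m n : nat)
    (F : V -> 'M[R]_(m, n)) :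
  (forall i j, exists k : R,
    forall x y, `|F x i j - F y i j| <= k * `|x - y|) ->
  exists k : R, forall x y, `|F x - F y| <= k * `|x - y|.
Proof.
move=> Flip.
have /choice[k kP] (ij : 'I_m * 'I_n) : exists k : R, forall x y,
    `|F x ij.1 ij.2 - F y ij.1 ij.2| <= k * `|x - y| by exact: Flip.
exists (\sum_ij `|k ij|) => x y; apply: ler_norm_entries => [|i j].
  by rewrite mulr_ge0// sumr_ge0.
rewrite !mxE; apply: (le_trans (kP (i, j) x y)); rewrite ler_wpM2r//.
by rewrite (bigD1 (i, j))//= (le_trans (ler_norm _))// lerDl sumr_ge0.
Qed.

Lemma usubmx_lipschitz (R : realType) (m1 m2 n : nat)
    (x y : 'M[R]_(m1 + m2, n)) :
  `|usubmx x - usubmx y| <= `|x - y|.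
Proof.
apply: ler_norm_entries => // i j; rewrite !mxE.
by have := ler_entry_norm (x - y) (lshift m2 i) j; rewrite !mxE.
Qed.

Lemma dsubmx_lipschitz (R : realType) (m1 m2 n : nat)
    (x y : 'M[R]_(m1 + m2, n)) :
  `|dsubmx x - dsubmx y| <= `|x - y|.
Proof.
apply: ler_norm_entries => // i j; rewrite !mxE.
by have := ler_entry_norm (x - y) (rshift m1 i) j; rewrite !mxE.
Qed.

(** * The cut-off vector field *)

Section cut_field_theory.
Variables (R : realType) (kappa c : R).
Hypothesis c0 : 0 < c.
Implicit Types A B : 'M[R]_2.

(** The determinant, multiplied by c / |B|^2 outside the ball |B|^2 <= c so as
to be bounded and Lipschitz. *)
Definition cut_det B : R := \det B * (c / Num.max c (inner B B)).

(** The multiplier [Lambda] with det B replaced by [cut_det] and |A|^2 by its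
maximum with 2, the least value of |A|^2 on SL(2). *)
Definition cut_Lambda A B : R :=
  2 * (kappa - cut_det B) / Num.max 2 (inner A A).

(** The acceleration of the modified equation. *)
Definition cut_accel A B : 'M[R]_2 := cut_Lambda A B *: cof A - kappa *: A.

Lemma cut_accelE A B i j :
  cut_accel A B i j = cut_Lambda A B * cof A i j - kappa * A i j.
Proof. by rewrite /cut_accel; set C := cof A; rewrite !mxE. Qed.

(** The modified equation as a first order system. The state (A, B) is stored as
the 4 x 2 matrix with A above B. *)
Definition cut_field (X : 'M[R]_(2 + 2, 2)) : 'M[R]_(2 + 2, 2) :=
  col_mx (dsubmx X) (cut_accel (usubmx X) (dsubmx X)).

Lemma bounded_lipschitz_cut_det : bounded_lipschitz cut_det.
Proof.
rewrite (_ : cut_det = fun B =>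
    c * (B 0 0 / cut_norm c B * (B 1 1 / cut_norm c B)
    - B 0 1 / cut_norm c B * (B 1 0 / cut_norm c B))).
  apply: bounded_lipschitzM; first exact: bounded_lipschitz_cst.
  apply: bounded_lipschitzB; apply: bounded_lipschitzM;
    exact: bounded_lipschitz_radial.
apply/funext => B; rewrite /cut_det det_mx2 -sqr_cut_norm//.
by field; rewrite gt_eqF// cut_norm_gt0.
Qed.

(** The reaction term is bounded although cof A is not: the denominator is
quadratic in A. *)
Lemma bounded_lipschitz_reaction i j : bounded_lipschitz
  (fun X : 'M[R]_(2 + 2, 2) =>
     cut_Lambda (usubmx X) (dsubmx X) * cof (usubmx X) i j).
Proof.
have two0 : 0 < 2 :> R by [].
pose sc A k l := A k l / cut_norm 2 A / cut_norm 2 A.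
have bsc k l : bounded_lipschitz (fun A => sc A k l).
  apply: bounded_lipschitzM; first exact: bounded_lipschitz_radial.
  exact: bounded_lipschitz_inv_cut_norm.
have bcof k l : bounded_lipschitz (fun A => cof A k l / Num.max 2 (inner A A)).
  have E : forall A p q, A p q / Num.max 2 (inner A A) = sc A p q.
    move=> A p q; rewrite /sc -sqr_cut_norm//.
    by field; rewrite gt_eqF// cut_norm_gt0.
  have N p q : bounded_lipschitz (fun A => - A p q / Num.max 2 (inner A A)).
    rewrite (_ : (fun _ => _) = fun A => 0 - sc A p q).
      by apply: bounded_lipschitzB => //; exact: bounded_lipschitz_cst.
    by apply/funext => A; rewrite mulNr E sub0r.
  have P p q : bounded_lipschitz (fun A => A p q / Num.max 2 (inner A A)).
    rewrite (_ : (fun _ => _) = fun A => sc A p q)//.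
    by apply/funext => A; rewrite E.
  move: k l; do 2 apply: forall_ord2.
  - by rewrite (_ : (fun _ => _) = fun A => A 1 1 / Num.max 2 (inner A A))//;
      apply/funext => A; rewrite cof2E.
  - by rewrite (_ : (fun _ => _) = fun A => - A 1 0 / Num.max 2 (inner A A))//;
      apply/funext => A; rewrite cof2E.
  - by rewrite (_ : (fun _ => _) = fun A => - A 0 1 / Num.max 2 (inner A A))//;
      apply/funext => A; rewrite cof2E.
  - by rewrite (_ : (fun _ => _) = fun A => A 0 0 / Num.max 2 (inner A A))//;
      apply/funext => A; rewrite cof2E.
rewrite (_ : (fun _ => _) = fun X : 'M[R]_(2 + 2, 2) =>
    2 * (kappa - cut_det (dsubmx X)) *
    (cof (usubmx X) i j / Num.max 2 (inner (usubmx X) (usubmx X)))); last first.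
  by apply/funext => X; rewrite /cut_Lambda mulrAC -mulrA.
apply: bounded_lipschitzM; last first.
  apply: (bounded_lipschitz_comp
    (f := fun A => cof A i j / Num.max 2 (inner A A))) => //.
  exact: usubmx_lipschitz.
apply: bounded_lipschitzM; first exact: bounded_lipschitz_cst.
apply: bounded_lipschitzB; first exact: bounded_lipschitz_cst.
apply: bounded_lipschitz_comp; first exact: dsubmx_lipschitz.
exact: bounded_lipschitz_cut_det.
Qed.

Lemma cut_field_lipschitz :
  exists k : R, forall X Y, `|cut_field X - cut_field Y| <= k * `|X - Y|.
Proof.
apply: lipschitz_entries => i j; case: (split_ordP i) => {}i ->.
  exists 1 => X Y; rewrite !col_mxEu !mxE mul1r.
  by have := ler_entry_norm (X - Y) (rshift 2 i) j; rewrite !mxE.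
have [k [k0 _ klip]] := bounded_lipschitz_reaction i j.
exists (k + `|kappa|) => X Y; rewrite !col_mxEd !cut_accelE.
have := klip X Y; set a := _ * cof _ _ _; set b := _ * cof _ _ _ => ab.
rewrite (_ : _ - _ = (a - b) - kappa * (usubmx X i j - usubmx Y i j));
  last by ring.
rewrite mulrDl; apply: (le_trans (ler_normB _ _)); apply: lerD => //.
rewrite normrM ler_wpM2l//.
by have := ler_entry_norm (X - Y) (lshift 2 i) j; rewrite !mxE.
Qed.

(** The cut-offs are inactive on SL(2) as long as |B|^2 <= c. *)
Lemma cut_Lambda_eq A B : \det A = 1 -> inner B B <= c ->
  cut_Lambda A B = Lambda kappa A B.
Proof.
move=> A1 Bc; rewrite /cut_Lambda /Lambda /cut_det /fnorm.
have := inner_ge2det A; rewrite A1 normr1 mulr1 => A2.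
rewrite (max_l Bc) (max_r A2) divff ?gt_eqF// mulr1.
by rewrite sqr_sqrtr// (le_trans _ A2).
Qed.

End cut_field_theory.

Section cut_bounds.
Variables (R : realType) (kappa c : R).
Hypotheses (kappa0 : 0 <= kappa) (c0 : 0 < c).
Implicit Types A B : 'M[R]_2.

Lemma cut_det_bound B : 2 * `|cut_det c B| <= c.
Proof.
have m0 : 0 < Num.max c (inner B B) by rewrite lt_max c0.
rewrite /cut_det normrM (gtr0_norm (divr_gt0 c0 m0)) !mulrA ler_pdivrMr//.
rewrite [leRHS]mulrC ler_pM2r// (le_trans (inner_ge2det _))//.
by rewrite le_max lexx orbT.
Qed.

(** The error of [cut_det] is controlled by the excess of |B|^2 over c. *)
Lemma cut_det_error B (e : R) : 0 <= e -> inner B B <= c + e ->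
  2 * `|\det B - cut_det c B| <= e.
Proof.
move=> e0 Be; have [Bc|Bc] := leP (inner B B) c.
  by rewrite /cut_det (max_l Bc) divff ?gt_eqF// mulr1 subrr normr0 mulr0.
have B0 := lt_trans c0 Bc.
rewrite /cut_det (max_r (ltW Bc)) -{1}(mulr1 (\det B)) -mulrBr normrM mulrA.
have u : 1 - c / inner B B = (inner B B - c) / inner B B.
  by field; rewrite gt_eqF.
have q : 0 <= (inner B B - c) / inner B B by rewrite divr_ge0 ?subr_ge0 ?ltW.
rewrite u (ger0_norm q).
rewrite mulrA ler_pdivrMr// mulrC; apply: ler_pM => //.
- by rewrite subr_ge0 ltW.
- by lra.
- exact: inner_ge2det.
Qed.

(** The truncation at 2 costs at most |det A - 1|, since |A|^2 >= 2 det A. *)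
Lemma cut_inner_error A :
  `|inner A A / Num.max 2 (inner A A) - 1| <= `|\det A - 1|.
Proof.
have [A2|A2] := leP 2 (inner A A).
  by rewrite divff ?subrr ?normr0// gt_eqF// (lt_le_trans _ A2).
have := inner_ge2det A; have := ler_norm (\det A) => h1 h2.
rewrite distrC ger0_norm; last by lra.
by rewrite distrC; apply: le_trans (ler_norm _); lra.
Qed.

Lemma cut_Lambda_bound A B : `|cut_Lambda kappa c A B| <= kappa + c / 2.
Proof.
rewrite /cut_Lambda normrM normfV.
have m2 : 2 <= Num.max 2 (inner A A) by rewrite le_max lexx.
rewrite (ger0_norm (le_trans (ler0n _ 2) m2)) ler_pdivrMr; last by lra.
rewrite normrM (ger0_norm (ler0n _ 2)) mulrC; apply: ler_pM => //.
have := cut_det_bound B; have := ler_normB kappa (cut_det c B).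
by rewrite (ger0_norm kappa0); lra.
Qed.

End cut_bounds.

(** * Conservation laws *)

Section matrix_curves.
Variables (R : realType).
Implicit Types (A B : R -> 'M[R]_2).

Lemma is_derive_inner A B (dA dB : 'M[R]_2) (t : R) :
  is_derive t (1 : R) A dA -> is_derive t (1 : R) B dB ->
  is_derive t (1 : R) (fun s => inner (A s) (B s))
    (inner dA (B t) + inner (A t) dB).
Proof.
move=> /is_derive_mxP Ad /is_derive_mxP Bd.
pose h i j (s : R) := A s i j * B s i j.
have hd i j : is_derive t (1 : R) (h i j) (A t i j * dB i j + B t i j * dA i j).
  exact: is_derive_mul.
rewrite (_ : (fun _ => _) = h 0 0 + h 0 1 + h 1 0 + h 1 1); last first.
  by apply/funext => s; rewrite inner2E.
apply: (is_derive_eq (is_deriveD (is_deriveD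
  (is_deriveD (hd 0 0) (hd 0 1)) (hd 1 0)) (hd 1 1))).
by rewrite !inner2E; ring.
Qed.

Lemma is_derive_cof A (dA : 'M[R]_2) (t : R) :
  is_derive t (1 : R) A dA -> is_derive t (1 : R) (fun s => cof (A s)) (cof dA).
Proof.
move=> /is_derive_mxP Ad; apply/is_derive_mxP.
do 2 apply: forall_ord2.
- rewrite (_ : (fun _ => _) = fun s => A s 1 1) ?cof2E//.
  by apply/funext => s; rewrite cof2E.
- rewrite (_ : (fun _ => _) = - (fun s => A s 1 0)) ?cof2E;
    first exact: is_deriveN.
  by apply/funext => s; rewrite cof2E.
- rewrite (_ : (fun _ => _) = - (fun s => A s 0 1)) ?cof2E;
    first exact: is_deriveN.
  by apply/funext => s; rewrite cof2E.
- rewrite (_ : (fun _ => _) = fun s => A s 0 0) ?cof2E//.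
  by apply/funext => s; rewrite cof2E.
Qed.

Lemma is_derive_det A (dA : 'M[R]_2) (t : R) :
  is_derive t (1 : R) A dA ->
  is_derive t (1 : R) (fun s => \det (A s)) (inner dA (cof (A t))).
Proof.
move=> /is_derive_mxP Ad.
rewrite (_ : (fun _ => _) = (fun s => A s 0 0 * A s 1 1) -
    (fun s => A s 0 1 * A s 1 0)).
  apply: (is_derive_eq (is_deriveB (is_derive_mul (Ad 0 0) (Ad 1 1))
    (is_derive_mul (Ad 0 1) (Ad 1 0)))).
  by rewrite inner2E !cof2E; ring.
by apply/funext => s; rewrite det_mx2.
Qed.

End matrix_curves.

(** The quadratic estimate behind |h'| <= C h for h = g^2 + p^2 + e^2. *)
Lemma gronwall_coefficient (R : realFieldType) (kappa K g p e dp de : R) :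
  0 <= kappa -> kappa <= K ->
  `|dp| <= `|e| + 2 * K * `|g| + 2 * kappa * `|g| -> `|de| <= 2 * K * `|p| ->
  `|2 * g * p + 2 * p * dp + 2 * e * de| <=
    (2 + 6 * K) * (g ^+ 2 + p ^+ 2 + e ^+ 2).
Proof.
move=> k0 kK dple dele.
have K0 : 0 <= K by lra.
rewrite -[g ^+ 2]real_normK ?num_real// -[p ^+ 2]real_normK ?num_real//.
rewrite -[e ^+ 2]real_normK ?num_real//.
apply: (le_trans (ler_normD _ _)).
apply: (le_trans (lerD (ler_normD _ _) (lexx _))).
rewrite !normrM (ger0_norm (ler0n _ 2)).
move: (normr_ge0 g) (normr_ge0 p) (normr_ge0 e) dple dele.
move: `|g| `|p| `|e| `|dp| `|de| => {}g {}p {}e {}dp {}de g0 p0 e0 dple dele.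
have h1 : p * dp <= p * (e + 4 * K * g).
  have kg : kappa * g <= K * g by rewrite ler_wpM2r.
  by rewrite ler_wpM2l//; lra.
have h2 : e * de <= e * (2 * K * p) by rewrite ler_wpM2l.
have s1 := sqr_ge0 (g - p); have s2 := sqr_ge0 (p - e).
have t1 : 0 <= K * (g - p) ^+ 2 by rewrite mulr_ge0.
have t2 : 0 <= K * (p - e) ^+ 2 by rewrite mulr_ge0.
have t3 : 0 <= K * g ^+ 2 by rewrite mulr_ge0// sqr_ge0.
have t4 : 0 <= K * e ^+ 2 by rewrite mulr_ge0// sqr_ge0.
have t5 : 0 <= K * p ^+ 2 by rewrite mulr_ge0// sqr_ge0.
have t6 := sqr_ge0 g; have t7 := sqr_ge0 e; have t8 := sqr_ge0 p.
lra.
Qed.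

(** Along the modified flow the determinant, the tangency condition and the
energy bound propagate from the initial state. *)
Lemma cut_solution_invariants (R : realType) (kappa c : R)
    (A B : R -> 'M[R]_2) :
  0 <= kappa -> 0 < c ->
  (forall t, is_derive t (1 : R) A (B t)) ->
  (forall t, is_derive t (1 : R) B (cut_accel kappa c (A t) (B t))) ->
  tangent_bundle (A 0, B 0) ->
  inner (B 0) (B 0) + kappa * inner (A 0) (A 0) <= c ->
  forall t, [/\ \det (A t) = 1, inner (B t) (cof (A t)) = 0
              & inner (B t) (B t) <= c].
Proof.
move=> k0 c0 dA dB [A1 B1] E0c.
have {}A1 : \det (A 0) = 1 := A1.
have {}B1 : inner (B 0) (cof (A 0)) = 0 := B1.
set E0 : R := _ + _ in E0c.
pose g t := \det (A t) - 1.
pose p t := inner (B t) (cof (A t)).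
pose e t := inner (B t) (B t) + kappa * inner (A t) (A t) - E0.
pose L t := cut_Lambda kappa c (A t) (B t).
pose K := kappa + c / 2.
pose dp t := L t * inner (A t) (A t) - 2 * kappa * \det (A t) + 2 * \det (B t).
have gd t : is_derive t (1 : R) g (p t).
  have := is_deriveB (is_derive_det (dA t)) (is_derive_cst (1 : R) t 1).
  by rewrite subr0.
have pd t : is_derive t (1 : R) p (dp t).
  apply: (is_derive_eq (is_derive_inner (dB t) (is_derive_cof (dA t)))).
  rewrite inner_cof /dp !inner2E !cut_accelE det_mx2 !cof2E -/(L t) det_mx2.
  by ring.
have ed t : is_derive t (1 : R) e (2 * L t * p t).
  have d1 := is_derive_inner (dB t) (dB t).
  have d2 := is_derive_mul (is_derive_cst kappa t 1)
    (is_derive_inner (dA t) (dA t)).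
  apply: (is_derive_eq (is_deriveB (is_deriveD d1 d2) (is_derive_cst E0 t 1))).
  by rewrite /p !inner2E !cut_accelE !cof2E -/(L t) /=; ring.
pose h t := g t ^+ 2 + p t ^+ 2 + e t ^+ 2.
have h0 t : 0 <= h t by rewrite !addr_ge0// sqr_ge0.
have hz : forall t, h t = 0.
  apply: (@gronwall0 R h _ (2 + 6 * K) (fun t => is_deriveD
    (is_deriveD (is_derive_sqr (gd t)) (is_derive_sqr (pd t)))
    (is_derive_sqr (ed t)))) => //.
    by rewrite /h /g /p /e A1 B1 !subrr expr0n !addr0.
  move=> t; apply: (@gronwall_coefficient _ kappa) => //.
  - by rewrite lerDl divr_ge0// ltW.
  - have m0 : 0 < Num.max 2 (inner (A t) (A t)) by rewrite lt_max ltr0n.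
    (* The first two summands are the cut-off errors. *)
    rewrite (_ : dp t = 2 * (\det (B t) - cut_det c (B t)) +
      2 * (kappa - cut_det c (B t)) *
        (inner (A t) (A t) / Num.max 2 (inner (A t) (A t)) - 1)
      - 2 * kappa * g t); last first.
      by rewrite /dp /L /cut_Lambda /g; field; rewrite gt_eqF.
    apply: (le_trans (ler_normB _ _)); apply: lerD; last first.
      by rewrite !normrM (ger0_norm k0) (ger0_norm (ler0n _ 2)).
    apply: (le_trans (ler_normD _ _)); apply: lerD.
      rewrite normrM (ger0_norm (ler0n _ 2)); apply: cut_det_error => //.
      have := ler_norm (e t); rewrite {1}/e.
      have : 0 <= kappa * inner (A t) (A t) by rewrite mulr_ge0// inner_ge0.
      by lra.
    rewrite normrM; apply: ler_pM => //; last exact: cut_inner_error.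
    rewrite normrM (ger0_norm (ler0n _ 2)) ler_pM2l//.
    have := cut_det_bound c0 (B t); have := ler_normB kappa (cut_det c (B t)).
    by rewrite (ger0_norm k0) /K; lra.
  - rewrite normrM [`|2 * L t|]normrM (ger0_norm (ler0n _ 2)).
    rewrite ler_wpM2r// ler_pM2l//.
    exact: cut_Lambda_bound.
move=> t; have := hz t; rewrite /h => hzt.
have s1 := sqr_ge0 (g t); have s2 := sqr_ge0 (p t); have s3 := sqr_ge0 (e t).
have /eqP : g t ^+ 2 = 0 by lra.
have /eqP : p t ^+ 2 = 0 by lra.
have /eqP : e t ^+ 2 = 0 by lra.
rewrite !sqrf_eq0 => /eqP e0 /eqP p0; rewrite subr_eq0 => /eqP g0; split => //.
have : 0 <= kappa * inner (A t) (A t) by rewrite mulr_ge0// inner_ge0.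
by move: e0; rewrite /e; lra.
Qed.

(** A solution of the original problem conserves the energy, hence never meets
the cut-offs and solves the modified system. *)
Lemma solution_cut_field (R : realType) (kappa : R) (A0 B0 : 'M[R]_2)
    (A : R -> 'M[R]_2) (c : R) : 0 <= kappa -> 0 < c ->
  inner B0 B0 + kappa * inner A0 A0 <= c -> solution kappa A0 B0 A ->
  let y t := col_mx (A t) (derive1 A t) in
  forall t, is_derive t (1 : R) y (cut_field kappa c (y t)).
Proof.
move=> k0 c0 E0c [[cA A1] [Ad Bd _] ode [A00 B00]] y.
pose B := derive1 A.
have dA t : is_derive t (1 : R) A (B t).
  by apply: DeriveDef => //; rewrite /B derive1E.
have dB t : is_derive t (1 : R) B
    (Lambda kappa (A t) (B t) *: cof (A t) - kappa *: A t).
  apply: DeriveDef; first exact: Bd.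
  by rewrite -derive1E -ode addrK.
have p0 t : inner (B t) (cof (A t)) = 0.
  have d1 := is_derive_det (dA t).
  rewrite (_ : (fun s => \det (A s)) = cst 1) in d1; last first.
    by apply/funext => s; exact: A1.
  have := @derive_val _ _ _ _ _ _ _ d1.
  by rewrite derive_cst => <-.
pose e t := inner (B t) (B t) + kappa * inner (A t) (A t).
have ed t : is_derive t (1 : R) e 0.
  have d1 := is_derive_inner (dB t) (dB t).
  have d2 := is_derive_mul (is_derive_cst kappa t 1)
    (is_derive_inner (dA t) (dA t)).
  apply: (is_derive_eq (is_deriveD d1 d2)).
  apply: (@etrans _ _ (2 * Lambda kappa (A t) (B t) * inner (B t) (cof (A t))));
    last first.
    by rewrite p0 mulr0.
  set l := Lambda _ _ _; rewrite /= !inner2E.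
  have E i j : (l *: cof (A t) - kappa *: A t) i j =
      l * cof (A t) i j - kappa * A t i j.
    by set C := cof _; rewrite !mxE.
  by rewrite !E !cof2E; ring.
have Bc t : inner (B t) (B t) <= c.
  have : e t = e 0 by exact: is_derive_0_is_cst.
  have : e 0 <= c by rewrite /e /B A00 B00.
  move=> /[swap] <-; apply: le_trans; rewrite lerDl.
  by rewrite mulr_ge0// inner_ge0.
have {}dB t : is_derive t (1 : R) B (cut_accel kappa c (A t) (B t)).
  by have := dB t; rewrite /cut_accel cut_Lambda_eq//; exact: A1.
move=> t; apply/is_derive_mxP => i j; rewrite /cut_field /y col_mxKu col_mxKd.
case: (split_ordP i) => {}i ->; rewrite ?col_mxEu ?col_mxEd.
  rewrite (_ : (fun _ => _) = fun s => A s i j).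
    exact: (is_derive_mxP _ _ _).1.
  by apply/funext => s; rewrite col_mxEu.
rewrite (_ : (fun _ => _) = fun s => B s i j).
  exact: (is_derive_mxP _ _ _).1.
by apply/funext => s; rewrite col_mxEd.
Qed.

(** * Existence and uniqueness *)

Lemma continuous_pair (T U V : topologicalType) (f : T -> U) (g : T -> V) :
  continuous f -> continuous g -> continuous (fun t => (f t, g t)).
Proof. by move=> cf cg t; apply: cvg_pair; [exact: cf|exact: cg]. Qed.

Unset Implicit Arguments.
Set Strict Implicit.

Theorem theorem5p5 (R : realType) (kappa : R) (A0 B0 : 'M[R]_2)
    (kappa_ge0 : 0 <= kappa) (AB0 : tangent_bundle (A0, B0)) :
  exists A : R -> 'M[R]_2,
    unique (solution kappa A0 B0) A /\
    C0 (@tangent_bundle R) (fun t : R => (A t, derive1 A t)).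
Proof.
(* The summand 1 only serves to make c positive. *)
pose c := 1 + (inner B0 B0 + kappa * inner A0 A0).
have E0 : 0 <= inner B0 B0 + kappa * inner A0 A0.
  by rewrite addr_ge0 ?inner_ge0// mulr_ge0// inner_ge0.
have c0 : 0 < c by rewrite ltr_wpDr.
have E0c : inner B0 B0 + kappa * inner A0 A0 <= c by rewrite lerDr.
have [k Flip] := cut_field_lipschitz kappa c0.
have [y [y0 dy]] := picard_lindelof_global (col_mx A0 B0) Flip.
pose A t := usubmx (y t); pose B t := dsubmx (y t).
have A00 : A 0 = A0 by rewrite /A y0 col_mxKu.
have B00 : B 0 = B0 by rewrite /B y0 col_mxKd.
have dA t : is_derive t (1 : R) A (B t).
  apply/is_derive_mxP => i j.
  have := (is_derive_mxP _ _ _).1 (dy t) (lshift 2 i) j; rewrite col_mxEu.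
  rewrite (_ : (fun _ => _) = fun s => A s i j)//.
  by apply/funext => s; rewrite !mxE.
have dB t : is_derive t (1 : R) B (cut_accel kappa c (A t) (B t)).
  apply/is_derive_mxP => i j.
  have := (is_derive_mxP _ _ _).1 (dy t) (rshift 2 i) j; rewrite col_mxEd.
  rewrite (_ : (fun _ => _) = fun s => B s i j)//.
  by apply/funext => s; rewrite !mxE.
have inv := @cut_solution_invariants R kappa c A B kappa_ge0 c0 dA dB.
rewrite A00 B00 in inv; have {}inv := inv AB0 E0c.
have AB : derive1 A = B.
  by apply/funext => t; rewrite derive1E; exact: derive_val.
have BC : derive1 B = fun t => cut_accel kappa c (A t) (B t).
  by apply/funext => t; rewrite derive1E; exact: derive_val.
have cA : continuous A by move=> t; exact: is_derive_continuous (dA t).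
have cB : continuous B by move=> t; exact: is_derive_continuous (dB t).
exists A; rewrite AB; split; last first.
  split; first exact: continuous_pair.
  by move=> t; have [] := inv t.
split.
  split; rewrite ?AB.
  - by split=> // t; have [] := inv t.
  - split=> [t|t|]; rewrite ?AB; [exact: ex_derive|exact: ex_derive|].
    rewrite BC => t.
    rewrite (_ : (fun _ => _) = dsubmx \o (cut_field kappa c \o y)); last first.
      by apply/funext => s /=; rewrite col_mxKd.
    apply: continuous_comp; last first.
      apply: (@lipschitz_continuous R _ _ 1) => X Y.
      by rewrite mul1r dsubmx_lipschitz.
    apply: continuous_comp; first exact: is_derive_continuous (dy t).
    exact: lipschitz_continuous Flip _.
  - move=> t; rewrite BC /cut_accel subrK cut_Lambda_eq//.
    + by have [] := inv t.
    + by have [] := inv t.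
  - by rewrite A00 B00.
move=> A' A'sol.
have dy' := solution_cut_field kappa_ge0 c0 E0c A'sol.
have [_ _ _ [A'0 B'0]] := A'sol.
have yE : y = fun t => col_mx (A' t) (derive1 A' t).
  by apply: (ode_unique Flip) => //; rewrite y0 A'0 B'0.
by apply/funext => t; rewrite /A yE col_mxKu.
Qed.
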